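(* Let $f$ be any $n$-variable Boolean function in $\varOmega$, i.e. the (nonsingular) feedback function of an $n$-stage feedback shift register all of whose cycles have lengths dividing $n+1$. Then either $v(f)=(1,0,1,0,\dots)$ and $\lambda_f=(1,1,0,0,\dots,0)$, or $v(f)=(0,1,0,1,\dots)$ and $\lambda_f=(0,1,0,0,\dots,0)$. Equivalently, either $f=f_P=x_1\oplus x_2\oplus\cdots\oplus x_n$ or $f=f_C=x_1\oplus x_2\oplus\cdots\oplus x_n\oplus 1$.
   Context: $F_2$ is the field with two elements and $\oplus$ is addition modulo 2. The $n$-stage feedback shift register (FSR) with feedback function $f:F_2^n\to F_2$ has state set $F_2^n$ and next-state operator $\rho(a_1,\dots,a_n)=(a_2,\dots,a_n,f(a_1,\dots,a_n))$. Only nonsingular feedback functions are considered, i.e. those of the form $f=x_1\oplus g(x_2,\dots,x_n)$ with $g$ a Boolean function of $n-1$ variables. A cycle of length (period) $l$ is a cyclic sequence of $l$ distinct states, each mapped by $\rho$ to the next and the last mapped to the first. $\varOmega$ denotes the class of $n$-stage FSRs (identified with their feedback functions) such that the periods of all cycles are factors of $n+1$. A Boolean function $f$ of $n$ variables is symmetric if it is invariant under every permutation of its variables. For symmetric $f$, the simplified value vector is $v(f)=(v_f(0),v_f(1),\dots,v_f(n))$, where $v_f:\{0,\dots,n\}\to F_2$ satisfies $f(x)=v_f(wt(x))$ for all $x\in F_2^n$ ($wt$ is the Hamming weight). Writing $X_{0,n}=1$ and $X_{j,n}=\bigoplus_{1\le i_1<\cdots<i_j\le n}x_{i_1}\cdots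 x_{i_j}$ for $1\le j\le n$, a symmetric $f$ is uniquely $f=\bigoplus_{i=0}^{n}\lambda_f(i)X_{i,n}$ with $\lambda_f(i)\in F_2$, and the simplified ANF vector is $\lambda_f=(\lambda_f(0),\lambda_f(1),\dots,\lambda_f(n))$. The statement about $v(f)$ and $\lambda_f$ includes the assertion that $f$ is symmetric; $(1,0,1,0,\dots)$ and $(0,1,0,1,\dots)$ denote alternating vectors of length $n+1$. *)

(* Defs.v *)
From HB Require Import structures.
From mathcomp Require Import all_boot all_order all_fingroup all_algebra.

Set Implicit Arguments.
Unset Strict Implicit.
Unset Printing Implicit Defensive.

Import GRing.Theory.
Local Open Scope ring_scope.

(* The variable x_i, 1 <= i <= n, is [tnth x (i - 1)]. *)
Notation state n := (n.-tuple 'F_2).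
Notation boolfun n := {ffun n.-tuple 'F_2 -> 'F_2}.

(* The default value of [nth] supplies the last coordinate:
   (a_1, ..., a_n) is sent to (a_2, ..., a_n, f (a_1, ..., a_n)). *)
Definition next_state n (f : boolfun n) (a : state n) : state n :=
  [tuple nth (f a) a i.+1 | i < n].

(* f = x_1 + g (x_2, ..., x_n); only meaningful for n > 0. *)
Definition nonsingular n (f : boolfun n) : Prop :=
  exists g : boolfun n.-1,
    forall x : state n, f x = head 0 x + g [tuple of behead x].

(* MathComp's [ufcycle] accepts the empty sequence, which is not a cycle
   of states. *)
Definition is_cycle n (f : boolfun n) (c : seq (state n)) : Prop :=
  c <> [::] /\ ufcycle (next_state f) c.

Definition in_Omega n (f : boolfun n) : Prop :=
  nonsingular f /\
  forall c : seq (state n), is_cycle f c -> (size c %| n.+1)%N.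

Definition symmetric_fun n (f : boolfun n) : Prop :=
  forall (s : 'S_n) (x : state n), f [tuple tnth x (s i) | i < n] = f x.

Definition wt n (x : state n) : nat := count_mem 1 x.

(* v = (v_f(0), ..., v_f(n)); such a v exists exactly when f is symmetric, and
   is then unique because every weight 0, ..., n is attained. *)
Definition is_value_vector n (f : boolfun n) (v : n.+1.-tuple 'F_2) : Prop :=
  forall x : state n, f x = v`_(wt x).

(* X_{j,n}, the sum of all monomials of degree j; for j = 0 the only term is
   the empty product, so that X_{0,n} = 1. *)
Definition Xsym n (j : nat) : boolfun n :=
  [ffun x : state n =>
    \sum_(I : {set 'I_n} | #|I| == j) \prod_(i in I) tnth x i].

(* l = (l_f(0), ..., l_f(n)), the coordinates of f in the linearly independent
   family X_{0,n}, ..., X_{n,n}, hence unique. *)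
Definition is_ANF_vector n (f : boolfun n) (l : n.+1.-tuple 'F_2) : Prop :=
  forall x : state n, f x = \sum_(i < n.+1) tnth l i * Xsym n i x.

Definition sym_with_vectors n (f : boolfun n) (v l : n.+1.-tuple 'F_2) : Prop :=
  [/\ symmetric_fun f, is_value_vector f v & is_ANF_vector f l].

Definition vec1010 n : n.+1.-tuple 'F_2 := [tuple (~~ odd i)%:R | i < n.+1].
Definition vec0101 n : n.+1.-tuple 'F_2 := [tuple (odd i)%:R | i < n.+1].

Definition vec1100 n : n.+1.-tuple 'F_2 := [tuple ((i <= 1)%N : nat)%:R | i < n.+1].
Definition vec0100 n : n.+1.-tuple 'F_2 := [tuple (i == 1 :> nat)%:R | i < n.+1].

Definition f_P n : boolfun n := [ffun x : state n => \sum_(i < n) tnth x i].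
Definition f_C n : boolfun n := [ffun x : state n => (\sum_(i < n) tnth x i) + 1].

(* Main.v *)
Require Import Defs.
From HB Require Import structures.
From mathcomp Require Import all_boot all_order all_fingroup all_algebra.

(** Write [rho] for the next-state operator and [c a = f a + (a_1 + ... + a_n)].
    The goal is that [c] is constant: its value then decides between [f_P] and
    [f_C], whose two vectors are computed directly.

    Nonsingularity makes [rho] injective, so every state lies on a cycle and the
    hypothesis on the periods says exactly that [rho ^ (n + 1)] is the identity.
    Since [rho] shifts, this means that the bit fed back after one step is the
    one which has just left the register: [f (rho a) = a_1]
    ([feedback_next_state]).  As [rho] removes [a_1] from the sum and inserts
    [f a], it follows that [c (rho a) = c a].  Moreover [c] does not change when
    [a_1] is flipped, because [f] and the sum both change; and flipping [a_1]
    changes the bit that [rho] inserts and nothing else of [rho a].  Hence [c]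
    is invariant under shifting in an arbitrary bit ([defect_shift_in]), and
    shifting in [n] zeros takes every state to the zero state
    ([defect_constant]).

    The vectors follow from the parity of the weight and from [X_0 = 1],
    [X_1 = x_1 + ... + x_n]; as a value vector determines its function, each of
    the two pairs of vectors characterizes [f_C] or [f_P]. *)

Set Implicit Arguments.
Unset Strict Implicit.
Unset Printing Implicit Defensive.

Import GRing.Theory.
Local Open Scope ring_scope.

(** * Bits and shifts *)

Lemma F2_eq01 (x : 'F_2) : x = 0 \/ x = 1.
Proof. by case: x => [[|[|k]]] // h; [left | right]; apply: val_inj. Qed.

Lemma F2_addrr (x : 'F_2) : x + x = 0.
Proof. by case: (F2_eq01 x) => ->; apply: val_inj. Qed.

Lemma F2_natr_odd (k : nat) : k%:R = (odd k)%:R :> 'F_2.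
Proof.
by elim: k => //= k IH; rewrite -natr1 IH; case: (odd k); apply: val_inj.
Qed.

Lemma sum_F2_wt n (x : state n) : \sum_(i < n) tnth x i = (wt x)%:R.
Proof.
rewrite -(big_tuple _ _ _ xpredT id) /wt; elim: (tval x) => [|y s IH].
  by rewrite big_nil.
by rewrite big_cons IH /= natrD; case: (F2_eq01 y) => ->.
Qed.

Definition shift_in n (a : state n) (t : 'F_2) : state n :=
  [tuple nth t a i.+1 | i < n].

Lemma nth_shift_in n (a : state n) (d t : 'F_2) (i : nat) :
  (i < n)%N -> nth d (shift_in a t) i = nth t a i.+1.
Proof.
by move=> hi; rewrite (nth_map (Ordinal hi)) ?size_enum_ord // nth_enum_ord.
Qed.

(** The default value 0 acts as an endless supply of the zeros shifted in: past
    the end of the register both sides vanish, and the rule can be iterated. *)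
Lemma nth_shift_in0 n (a : state n) (i : nat) :
  nth 0 (shift_in a 0) i = nth 0 a i.+1.
Proof.
case: (ltnP i n) => hi; first exact: nth_shift_in.
by rewrite !nth_default ?size_tuple // ltnW.
Qed.

Lemma val_shift_in_cons m x (s : state m) (t : 'F_2) :
  shift_in [tuple of x :: s] t = rcons s t :> seq 'F_2.
Proof.
have hsz : size (shift_in [tuple of x :: s] t) = m.+1 by rewrite size_tuple.
apply: (@eq_from_nth _ 0) => [|i]; first by rewrite hsz size_rcons size_tuple.
rewrite hsz => hi; rewrite nth_shift_in //= nth_rcons size_tuple.
case: ltngtP => him.
- by apply: set_nth_default; rewrite size_tuple.
- by move: hi; rewrite ltnS leqNgt him.
- by rewrite nth_default // size_tuple him.
Qed.

Lemma iter_shift_in0 n (a : state n) :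
  iter n (fun b => shift_in b 0) a = [tuple 0 | _ < n].
Proof.
have H k i : nth 0 (iter k (fun b => shift_in b 0) a) i = nth 0 a (k + i).
  by elim: k i => [//|k IH] i; rewrite iterS nth_shift_in0 IH addnS.
apply: eq_from_tnth => i; rewrite tnth_mktuple (tnth_nth 0) H.
by rewrite nth_default // size_tuple leq_addr.
Qed.

(** * Rigidity of the feedback function *)

Section Feedback.

Variables (m : nat) (f : boolfun m.+1).

Lemma next_stateE (a : state m.+1) : next_state f a = shift_in a (f a).
Proof. by []. Qed.

Lemma nonsingular_cons :
  nonsingular f ->
  exists g : state m -> 'F_2, forall x (s : state m), f [tuple of x :: s] = x + g s.
Proof.
move=> [g hg]; exists g => x s; rewrite hg /=.
by congr (_ + g _); apply: val_inj.
Qed.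

Lemma next_state_inj : nonsingular f -> injective (next_state f).
Proof.
case/nonsingular_cons=> g hg a b.
case/tupleP: a => x s; case/tupleP: b => y t.
move/(congr1 (@tval _ _)); rewrite !next_stateE !val_shift_in_cons.
move/rcons_inj=> [/val_inj <-]; rewrite !hg => /addIr -> //.
Qed.

(** The orbit of [a] under the injective map [next_state f] is a cycle, and its
    length divides [n + 1]. *)
Lemma in_Omega_iter_id (a : state m.+1) :
  in_Omega f -> iter m.+2 (next_state f) a = a.
Proof.
case=> hns hc; have hi := next_state_inj hns.
have /hc : is_cycle f (fingraph.orbit (next_state f) a).
  split; last by apply/andP; rewrite fingraph.cycle_orbit ?fingraph.orbit_uniq.
  by move=> h; have := fingraph.in_orbit (next_state f) a; rewrite h.
rewrite fingraph.size_orbit => /dvdnP [q ->].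
by rewrite iterM; elim: q => //= q ->; rewrite iter_order.
Qed.

Lemma head_iter_next_state (a : state m.+1) (i : nat) :
  (i < m.+1)%N -> nth 0 a i = nth 0 (iter i (next_state f) a) 0.
Proof.
elim: i a => [//|i IH] a hi; rewrite iterSr -IH ?(ltnW hi) //.
rewrite next_stateE nth_shift_in ?(ltnW hi) //.
by apply: set_nth_default; rewrite size_tuple.
Qed.

(** [f (rho a)] is the last bit of [rho (rho a)], hence, [n - 1] steps later, the
    first bit of [rho ^ (n + 1) a = a]. *)
Lemma feedback_next_state (a : state m.+1) :
  in_Omega f -> f (next_state f a) = nth 0 a 0.
Proof.
move=> hf; set b := next_state f a.
have -> : f b = nth 0 (next_state f b) m.
  by rewrite next_stateE nth_shift_in // nth_default // size_tuple.
by rewrite head_iter_next_state // -!iterSr in_Omega_iter_id.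
Qed.

(** The deviation of [f] from the parity of the state. *)
Definition defect (a : state m.+1) : 'F_2 := f a + \sum_(y <- a) y.

Lemma defect_next_state (a : state m.+1) :
  in_Omega f -> defect (next_state f a) = defect a.
Proof.
move=> hf; rewrite /defect feedback_next_state // next_stateE.
case/tupleP: a => x s; rewrite val_shift_in_cons big_rcons /= big_cons.
by rewrite addrA [RHS]addrC.
Qed.

(** Changing [x] into [y = t + g s] turns the shift by [t] into a genuine step of
    the register, and alters [f] and the sum by the same amount. *)
Lemma defect_shift_in (a : state m.+1) (t : 'F_2) :
  in_Omega f -> defect (shift_in a t) = defect a.
Proof.
move=> hf; have [g hg] := nonsingular_cons hf.1.
case/tupleP: a => x s.
pose y := t + g s; pose b := [tuple of y :: s].
have -> : shift_in [tuple of x :: s] t = next_state f b.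
  apply: val_inj; rewrite next_stateE [LHS]val_shift_in_cons /b hg.
  rewrite [RHS]val_shift_in_cons /y.
  by rewrite -addrA F2_addrr addr0.
rewrite defect_next_state // /defect !hg /= !big_cons.
by rewrite ![_ + g s + _]addrACA !F2_addrr.
Qed.

Lemma defect_constant (a : state m.+1) :
  in_Omega f -> defect a = defect [tuple 0 | _ < m.+1].
Proof.
move=> hf; rewrite -(iter_shift_in0 a).
by elim: {2}m.+1 => [//|k IH]; rewrite iterS defect_shift_in.
Qed.

Lemma in_Omega_f_P_or_f_C : in_Omega f -> f = f_P m.+1 \/ f = f_C m.+1.
Proof.
move=> hf; pose c := defect [tuple 0 | _ < m.+1].
have H a : f a = \sum_(i < m.+1) tnth a i + c.
  rewrite /c -(defect_constant a hf) /defect addrCA.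
  by rewrite (big_tuple _ _ _ xpredT id) F2_addrr addr0.
case: (F2_eq01 c) => hc; [left | right]; apply/ffunP => a;
  by rewrite ffunE H hc ?addr0.
Qed.

End Feedback.

(** * Value vectors and algebraic normal forms of the two parity functions *)

Lemma value_vector_inj n (f g : boolfun n) v :
  is_value_vector f v -> is_value_vector g v -> f = g.
Proof. by move=> hf hg; apply/ffunP => x; rewrite hf hg. Qed.

Lemma wt_ltn n (x : state n) : (wt x < n.+1)%N.
Proof. by rewrite ltnS -{2}(size_tuple x) count_size. Qed.

Lemma sum_tnth_perm n (s : 'S_n) (x : state n) :
  \sum_(i < n) tnth [tuple tnth x (s i) | i < n] i = \sum_(i < n) tnth x i.
Proof.
rewrite [RHS](reindex_inj (@perm_inj _ s)).
by apply: eq_bigr => i _; rewrite tnth_mktuple.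
Qed.

Lemma Xsym0 n (x : state n) : Xsym n 0 x = 1.
Proof.
rewrite ffunE (big_pred1 set0) ?big_set0 // => I.
by rewrite cards_eq0.
Qed.

Lemma Xsym1 n (x : state n) : Xsym n 1 x = \sum_(i < n) tnth x i.
Proof.
rewrite ffunE.
rewrite (eq_bigl (mem ((@set1 'I_n) @: 'I_n))) => [|I /=].
  rewrite big_imset /=; last by move=> i j _ _ /set1_inj.
  by apply: eq_bigr => i _; rewrite big_set1.
by apply/cards1P/imsetP => [[i ->]|[i _ ->]]; exists i.
Qed.

Lemma is_ANF_vector_affine m (f : boolfun m.+1) (l : m.+2.-tuple 'F_2) :
    (forall i, (1 < i)%N -> l`_i = 0) ->
    (forall x, f x = l`_0 + l`_1 * \sum_(i < m.+1) tnth x i) ->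
  is_ANF_vector f l.
Proof.
move=> hl hf x; rewrite 2!big_ord_recl big1 => [|i _].
  by rewrite addr0 Xsym0 Xsym1 mulr1 hf !(tnth_nth 0).
by rewrite (tnth_nth 0) hl ?mul0r.
Qed.

Lemma nth_mktuple_nat n (F : nat -> 'F_2) i :
  (i < n)%N -> [tuple F j | j < n]`_i = F i.
Proof. by move=> hi; rewrite -[i]/(val (Ordinal hi)) -tnth_nth tnth_mktuple. Qed.

Lemma f_C_vectors m :
  sym_with_vectors (f_C m.+1) (vec1010 m.+1) (vec1100 m.+1).
Proof.
split=> [s x|x|].
- by rewrite !ffunE sum_tnth_perm.
- rewrite ffunE sum_F2_wt F2_natr_odd.
  rewrite (nth_mktuple_nat (fun i => (~~ odd i)%:R)) ?wt_ltn //.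
  by case: (odd _); apply: val_inj.
- apply: is_ANF_vector_affine => [i hi|x].
    case: (ltnP i m.+2) => him; last by rewrite nth_default ?size_tuple.
    rewrite (nth_mktuple_nat (fun i => ((i <= 1)%N : nat)%:R)) //.
    by rewrite leqNgt hi.
  rewrite !(nth_mktuple_nat (fun i => ((i <= 1)%N : nat)%:R)) //.
  by rewrite ffunE addrC mul1r.
Qed.

Lemma f_P_vectors m :
  sym_with_vectors (f_P m.+1) (vec0101 m.+1) (vec0100 m.+1).
Proof.
split=> [s x|x|].
- by rewrite !ffunE sum_tnth_perm.
- rewrite ffunE sum_F2_wt F2_natr_odd.
  by rewrite (nth_mktuple_nat (fun i => (odd i)%:R)) ?wt_ltn.
- apply: is_ANF_vector_affine => [i hi|x].
    case: (ltnP i m.+2) => him; last by rewrite nth_default ?size_tuple.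
    rewrite (nth_mktuple_nat (fun i => (i == 1 :> nat)%:R)) //.
    by rewrite gtn_eqF.
  rewrite !(nth_mktuple_nat (fun i => (i == 1 :> nat)%:R)) //.
  by rewrite ffunE mul1r add0r.
Qed.

Theorem corollary1 (n : nat) (hn : (0 < n)%N) (f : boolfun n)
    (hf : in_Omega f) :
  [/\ sym_with_vectors f (vec1010 n) (vec1100 n) \/
      sym_with_vectors f (vec0101 n) (vec0100 n),
      f = f_P n \/ f = f_C n,
      (sym_with_vectors f (vec1010 n) (vec1100 n) <-> f = f_C n) &
      (sym_with_vectors f (vec0101 n) (vec0100 n) <-> f = f_P n)].
Proof.
case: n hn f hf => // m _ f hf.
have hC := f_C_vectors m; have hP := f_P_vectors m.
have hPC := in_Omega_f_P_or_f_C hf.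
split=> //.
- by case: hPC => ->; [right | left].
- split=> [[_ h _]|-> //]; case: hC => _ h' _; exact: value_vector_inj h h'.
- split=> [[_ h _]|-> //]; case: hP => _ h' _; exact: value_vector_inj h h'.
Qed.
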